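(* Let $f_t\in\mathcal{S}^{2,1}_{\mu_t,L_t}(\mathbb{R}^n\times\mathbb{R}^n)$ for all $t\ge 1$, with $0<\mu_{\min}\le\mu_t\le L_t\le L_{\max}<\infty$ for all $t\ge1$. Let $$\kappa:=\frac{2L_{\max}+\mu_{\min}}{2},\qquad \delta:=\frac{2L_{\max}-\mu_{\min}}{2L_{\max}+\mu_{\min}},$$ and suppose that for a constant $\theta>0$ with $\theta<(1-\delta)/2$ the off-diagonal Hessian blocks satisfy $\|\mathbf{E}_t(\underline{\mathbf{x}})\|\le\kappa\theta$ for all $t\ge0$ and all arguments $\underline{\mathbf{x}}$. Suppose also that there is a constant $M_x$ such that the isolated minimizers satisfy $$\left\|\begin{bmatrix}\bar{\mathbf{x}}_{t-1|t}\\ \bar{\mathbf{x}}_{t|t}\end{bmatrix}\right\|\le M_x\qquad\text{for all } t\ge 1.$$ Let $\{\mathbf{x}_t^*\}$, $\mathbf{x}_t^*=\lim_{T\to\infty}\hat{\mathbf{x}}_{t|T}$, denote the untruncated asymptotic solutions and $\{\mathbf{z}_t^*\}$ the final truncated solutions for a buffer of size $B$. Then $$\|\mathbf{x}_t^*-\mathbf{z}_t^*\|\le C_b\left(\frac{2L_{\max}-\mu_{\min}}{2L_{\max}+\mu_{\min}}\right)^{B}$$ for some positive constant $C_b=C_b(\mu_{\min},L_{\max})$.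
   Context: $\mathcal{S}^{2,1}_{\mu,L}(\mathcal{D})$ is the class of $\mu$-strongly convex functions on $\mathcal{D}$ with two continuous derivatives whose first derivative (gradient) is $L$-Lipschitz continuous on $\mathcal{D}$. For $T\ge1$, $J_T(\mathbf{x}_0,\dots,\mathbf{x}_T)=\sum_{t=1}^T f_t(\mathbf{x}_{t-1},\mathbf{x}_t)$ with each $\mathbf{x}_t\in\mathbb{R}^n$, and $(\hat{\mathbf{x}}_{0|T},\dots,\hat{\mathbf{x}}_{T|T})$ denotes the (unique) minimizer of $J_T$. Under the hypotheses of the claim the limits $\mathbf{x}_t^*$ exist. The isolated minimizers are $(\bar{\mathbf{x}}_{t-1|t},\bar{\mathbf{x}}_{t|t}):=\arg\min_{\mathbf{x}_{t-1},\mathbf{x}_t}f_t(\mathbf{x}_{t-1},\mathbf{x}_t)$. $\mathbf{E}_t(\underline{\mathbf{x}})=\nabla_{t+1,t}f_{t+1}(\mathbf{x}_t,\mathbf{x}_{t+1})$ is the $n\times n$ matrix of mixed second partial derivatives $\partial^2 f_{t+1}/\partial\mathbf{x}_{t+1}\partial\mathbf{x}_t$, i.e. the off-diagonal block of the (block-tridiagonal) Hessian of $J_T$. Truncated solutions $\hat{\mathbf{z}}_{t|T}$ with buffer size $B$: the problem of minimizing $J_T$ is solved as $T$ increases while updating, at each time step, only the $B$ most recent frames; frames that have left the buffer are frozen. That is, at time step $T$ the frame $T-B$ is fixed at its final value $\mathbf{z}^*_{T-B}$ as a boundary condition and the last $B$ terms of the sum are minimized: $(\hat{\mathbf{z}}_{T-B+1|T},\dots,\hat{\mathbf{z}}_{T|T})$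 is the minimizer over $(\mathbf{z}_{T-B+1},\dots,\mathbf{z}_T)$ of $$f_{T-B+1}(\mathbf{z}^*_{T-B},\mathbf{z}_{T-B+1})+\sum_{t=T-B+2}^{T}f_t(\mathbf{z}_{t-1},\mathbf{z}_t).$$ The final value of frame $t$ is its value at the last round at which it is updated, $\mathbf{z}_t^*=\hat{\mathbf{z}}_{t|t+B-1}$, and it is unchanged afterwards. $\|\cdot\|$ is the Euclidean norm for vectors and the induced operator norm for matrices.
   Formalization: The constant C_b may also depend on M_x: by scaling the f_t, no constant depending only on μ_min and L_max can work. For B=1 the initial frozen frame z*_0, otherwise undefined (empty sum J_0), is taken from the minimizer of J_1. *)

(* Defs.v *)
From HB Require Import structures.
From mathcomp Require Import all_boot all_order all_algebra.
From mathcomp Require Import all_classical all_reals all_analysis.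

Set Implicit Arguments.
Unset Strict Implicit.
Unset Printing Implicit Defensive.

Import Order.TTheory GRing.Theory Num.Theory.
Import numFieldNormedType.Exports.

Local Open Scope classical_set_scope.
Local Open Scope ring_scope.

(* The norm `|v| on matrices is the max norm, not the Euclidean one. *)
Definition enorm (R : realType) (n : nat) (v : 'cV[R]_n) : R :=
  Num.sqrt (\sum_(i < n) v i 0 ^+ 2).

Definition opnorm (R : realType) (m n : nat) (A : 'M[R]_(m, n)) : R :=
  sup [set enorm (A *m x) | x in [set x : 'cV[R]_n | enorm x <= 1]].

Section Smoothness.
Variables (R : realType) (m : nat).
Implicit Types (f : 'cV[R]_m -> R) (p : 'cV[R]_m).

Definition partial (i : 'I_m) f : 'cV[R]_m -> R :=
  fun p => 'D_(delta_mx i 0) f p.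

Definition has_partial (i : 'I_m) f : Prop :=
  forall p, derivable f p (delta_mx i 0).

Definition grad f p : 'cV[R]_m := \col_i partial i f p.

Definition hessian f p : 'M[R]_m := \matrix_(i, j) partial i (partial j f) p.

(* 'D_v is total, so existence of the partials has to be required. *)
Definition C2 f : Prop :=
  (forall i, has_partial i f /\ continuous (partial i f)) /\
  (forall i j, has_partial i (partial j f) /\
               continuous (partial i (partial j f))).

Definition strongly_convex (mu : R) f : Prop :=
  forall (p q : 'cV[R]_m) (a : R), 0 <= a <= 1 ->
    f (a *: p + (1 - a) *: q) <=
      a * f p + (1 - a) * f q - mu / 2 * (a * (1 - a)) * enorm (p - q) ^+ 2.

(* The class S^{2,1}_{mu,L} on the whole space R^m. *)
Definition S21 (mu L : R) f : Prop :=
  [/\ strongly_convex mu f, C2 f &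
      forall p q, enorm (grad f p - grad f q) <= L * enorm (p - q)].

End Smoothness.

Definition is_argmin (R : realType) (V : Type) (g : V -> R) (x : V) : Prop :=
  forall y, g x <= g y.

Section Streaming.
Variables (R : realType) (n : nat).

(* R^n x R^n is 'cV_(n + n), the pair (u, v) being col_mx u v. *)
Variable f : nat -> 'cV[R]_(n + n) -> R.

(* Frames are indexed by all of nat; J T x only depends on x 0, ..., x T, so
   minimizing it over sequences is minimizing it over those frames, and a
   minimizer is determined at the indices 0, ..., T only. *)
Definition J (T : nat) (x : nat -> 'cV[R]_n) : R :=
  \sum_(1 <= t < T.+1) f t (col_mx (x t.-1) (x t)).

(* Rows are differentiated in x_{t+1}, columns in x_t. *)
Definition offdiag (t : nat) (x : nat -> 'cV[R]_n) : 'M[R]_n :=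
  dlsubmx (hessian (f t.+1) (col_mx (x t) (x t.+1))).

Definition trunc_cost (B T : nat) (w : 'cV[R]_n) (z : nat -> 'cV[R]_n) : R :=
  f (T - B).+1 (col_mx w (z (T - B).+1)) +
  \sum_((T - B).+2 <= t < T.+1) f t (col_mx (z t.-1) (z t)).

(* [z T t] is frame t after round T; this is frame t when it leaves the
   buffer. *)
Definition final_frame (B : nat) (z : nat -> nat -> 'cV[R]_n) (t : nat) :=
  z (t + B - 1)%N t.

(* Before any frame has left the buffer (T < B) the whole of J T is minimized.
   The maxn matters only for B = 1: there final_frame 0 is z 0 0, but J 0 is an
   empty sum with no unique minimizer, so frame 0 is taken from the first
   actual problem J 1. For B >= 2 round 0 is never used. *)
Definition truncated_solution (B : nat) (z : nat -> nat -> 'cV[R]_n) : Prop :=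
  [/\ forall T, (T < B)%N -> is_argmin (J (maxn T 1)) (z T),
      forall T, (B <= T)%N ->
        is_argmin (trunc_cost B T (final_frame B z (T - B)%N)) (z T) &
      forall T t, (t + B <= T)%N -> z T t = final_frame B z t].

End Streaming.

(* Main.v *)
Require Import Defs.
From HB Require Import structures.
From mathcomp Require Import all_boot all_order all_algebra.
From mathcomp Require Import all_classical all_reals all_analysis.
From mathcomp Require Import ring lra zify.
Set Implicit Arguments.
Unset Strict Implicit.
Unset Printing Implicit Defensive.

Import Order.TTheory GRing.Theory Num.Theory.
Import numFieldNormedType.Exports.
Local Open Scope classical_set_scope.
Local Open Scope ring_scope.

(* The bound on theta says exactly that the mixed Hessian blocks have norm at
   most mu_min / 2.  Strong convexity gives each interior frame curvature
   2 mu_min, coming from its two terms, so two sequences x, z that both satisfy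
   the optimality condition of frame t obey
     4 |x_t - z_t| <= |x_(t-1) - z_(t-1)| + |x_(t+1) - z_(t+1)|.
   Such sequences decay at rate 1/3 away from the ends of the horizon, and
   1/3 <= delta since mu_min <= L_max.  The same comparison with the isolated
   minimizers, at the frame of largest norm, bounds all solutions by a multiple
   of M_x.  At the round in which frame t leaves the buffer, the discrepancy
   with the untruncated solution is thus at most 3/8 of that of frame t - 1 plus
   a constant times 3^-B, and these contributions sum to O(3^-B).

   The frame inequality is obtained from function values alone: the growth
   inequalities at two minimizers are added, and what remains are second
   differences of f, controlled by the mixed Hessian block. *)

Section Lines.
Variables (R : realType) (V : normedModType R).
Implicit Types (f : V -> R) (p q v w : V).

Lemma is_derive_line f p v (s D : R) :
  is_derive (p + s *: v) v f D <-> is_derive s 1 (fun r => f (p + r *: v)) D.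
Proof.
have E : (fun h => h^-1 *: ((f \o shift (p + s *: v)) (h *: v) -
      f (p + s *: v))) =
    (fun h => h^-1 *: (((fun r => f (p + r *: v)) \o shift s) (h *: 1) -
      f (p + s *: v))).
  apply/funext => h /=.
  by rewrite [h%:A]mulr1 scalerDl addrCA.
by split=> -[d e]; split; move: d e; rewrite /derivable /derive ?E.
Qed.

Lemma is_derive_scale f p w (c D : R) :
  is_derive p w f D -> is_derive p (c *: w) f (c * D).
Proof.
move=> d.
have /is_derive_line d0 : is_derive (p + 0 *: w) w f D by rewrite scale0r addr0.
have : is_derive (p + (0 : R) *: (c *: w)) (c *: w) f (c * D).
  apply/is_derive_line.
  have -> : (fun r : R => f (p + r *: (c *: w))) =
            (fun r : R => f (p + r *: w)) \o (fun r => c * r).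
    by apply/funext => r /=; rewrite scalerA mulrC.
  rewrite mulrC; apply: is_derive1_comp.
    by rewrite mulr0.
  rewrite -[X in is_derive _ _ _ X]mulr1.
  exact: (@is_deriveZ _ _ R^o id c 0 1 1).
by rewrite scale0r addr0.
Qed.

Lemma MVT_line f p v : (forall q, derivable f q v) ->
  exists2 s : R, 0 <= s <= 1 & f (p + v) - f p = 'D_v f (p + s *: v).
Proof.
move=> df.
have d (s : R) : is_derive s 1 (fun r : R => f (p + r *: v)) ('D_v f (p + s *: v)).
  by apply/is_derive_line; exact: derivableP.
have cf : {within `[0, 1], continuous (fun r : R => f (p + r *: v))}.
  by apply: derivable_within_continuous => x _; exact: ex_derive.
have [c cI] := MVT_segment ler01 (fun x _ => d x) cf.
rewrite scale1r scale0r addr0 subr0 mulr1 => ->.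
by exists c => //; move: cI; rewrite in_itv.
Qed.

(* No derivability along v near p is assumed: only the w-increments are estimated
   by the mean value theorem, uniformly in the base point p + h v. *)
Lemma is_deriveDv f p v w (A : R) :
    is_derive p v f A -> (forall q, derivable f q w) ->
    {for p, continuous ('D_w f)} ->
  is_derive p (v + w) f (A + 'D_w f p).
Proof.
move=> dA dw cw.
suff C : (fun h => h^-1 *: ((f \o shift p) (h *: (v + w)) - f p)) @ (0:R)^' -->
         A + 'D_w f p.
  split; first by apply/cvg_ex; eexists; exact: C.
  by apply: cvg_lim => //; exact: C.
have -> : (fun h => h^-1 *: ((f \o shift p) (h *: (v + w)) - f p)) =
  (fun h => h^-1 *: ((f \o shift p) (h *: v) - f p)) \+
  (fun h => h^-1 *: (f ((h *: v + p) + h *: w) - f (h *: v + p))).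
  apply/funext => h /=; rewrite -scalerDr; congr (_ *: _).
  by rewrite [RHS]addrC addrA subrK scalerDr addrAC.
apply: cvgD; first by case: dA => dA <-; exact: dA.
apply/cvgrPdist_lt => e e0.
have /cvgrPdist_lt/(_ _ e0) := cw.
rewrite -nbhs_nearE => /nbhs_normP[d /= d0 H].
have b0 : 0 < `|v| + `|w| + 1 by rewrite ltr_wpDl// addr_ge0.
near=> h.
have h0 : h != 0 by near: h; exact: nbhs_dnbhs_neq.
have [q|s s01 ->] := @MVT_line f (h *: v + p) (h *: w).
  by have [] := @is_derive_scale f q w h _ (derivableP (dw q)).
set q := h *: v + p + _.
have [_ ->] := is_derive_scale h (derivableP (dw q)).
rewrite [_ *: _]mulrA mulVf// mul1r; apply: H => /=.
have -> : p - q = - h *: (v + s *: w).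
  rewrite /q scaleNr scalerDr !scalerA [s * h]mulrC.
  by rewrite [h *: v + p]addrC -addrA opprD addrA subrr sub0r.
rewrite normrZ normrN.
apply: (@le_lt_trans _ _ (`|h| * (`|v| + `|w| + 1))).
  rewrite ler_wpM2l// (le_trans (ler_normD _ _))// normrZ.
  case/andP: s01 => s0 s1; rewrite ger0_norm//.
  have : s * `|w| <= `|w| by rewrite ler_piMl.
  by lra.
rewrite -ltr_pdivlMr//; near: h; apply: dnbhs0_lt.
by rewrite divr_gt0.
Unshelve. all: by end_near. Qed.


Lemma is_derive_shift f p v w (D : R) :
  is_derive (p + w) v f D -> is_derive p v (fun q => f (q + w)) D.
Proof.
move=> /= [d e]; have E : (fun h : R => h^-1 *: (((fun q => f (q + w)) \o shift p)
    (h *: v) - f (p + w))) =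
    (fun h : R => h^-1 *: ((f \o shift (p + w)) (h *: v) - f (p + w))).
  by apply/funext => h /=; rewrite addrA.
by split; move: d e; rewrite /derivable /derive E.
Qed.

End Lines.

Section Euclid.
Variable R : realType.

Definition dot n (u v : 'cV[R]_n) : R := \sum_(i < n) u i 0 * v i 0.

Lemma dotC n (u v : 'cV[R]_n) : dot u v = dot v u.
Proof. by apply: eq_bigr => i _; rewrite mulrC. Qed.

Lemma dotDl n (u v w : 'cV[R]_n) : dot (u + v) w = dot u w + dot v w.
Proof. by rewrite -big_split; apply: eq_bigr => i _; rewrite mxE mulrDl. Qed.

Lemma dotZl n (a : R) (u w : 'cV[R]_n) : dot (a *: u) w = a * dot u w.
Proof. by rewrite mulr_sumr; apply: eq_bigr => i _; rewrite mxE mulrA. Qed.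

Lemma dotDr n (u v w : 'cV[R]_n) : dot w (u + v) = dot w u + dot w v.
Proof. by rewrite dotC dotDl !(dotC w). Qed.

Lemma dotZr n (a : R) (u w : 'cV[R]_n) : dot w (a *: u) = a * dot w u.
Proof. by rewrite dotC dotZl dotC. Qed.

Lemma dot_ge0 n (u : 'cV[R]_n) : 0 <= dot u u.
Proof. by apply: sumr_ge0 => i _; rewrite -expr2 sqr_ge0. Qed.

Lemma enormE n (u : 'cV[R]_n) : enorm u = Num.sqrt (dot u u).
Proof. by congr Num.sqrt; apply: eq_bigr => i _; rewrite expr2. Qed.

Lemma enorm_ge0 n (u : 'cV[R]_n) : 0 <= enorm u.
Proof. exact: sqrtr_ge0. Qed.

Lemma sqr_enorm n (u : 'cV[R]_n) : enorm u ^+ 2 = dot u u.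
Proof. by rewrite enormE sqr_sqrtr// dot_ge0. Qed.

Lemma enormZ n (a : R) (u : 'cV[R]_n) : enorm (a *: u) = `|a| * enorm u.
Proof.
by rewrite !enormE !(dotZl, dotZr) mulrA -expr2 sqrtrM ?sqr_ge0// sqrtr_sqr.
Qed.

Lemma enormN n (u : 'cV[R]_n) : enorm (- u) = enorm u.
Proof. by rewrite -scaleN1r enormZ normrN1 mul1r. Qed.

Lemma enormB n (u v : 'cV[R]_n) : enorm (u - v) = enorm (v - u).
Proof. by rewrite -opprB enormN. Qed.

Lemma enorm0_eq n (u : 'cV[R]_n) : enorm u = 0 -> u = 0.
Proof.
move=> u0; have : dot u u = 0 by rewrite -sqr_enorm u0 expr0n.
move=> /eqP; rewrite psumr_eq0; last by move=> i _; rewrite -expr2 sqr_ge0.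
move=> /allP h; apply/colP => i; rewrite mxE.
by have := h i (mem_index_enum _); rewrite /= -expr2 sqrf_eq0 => /eqP.
Qed.

Lemma normr_dot n (u v : 'cV[R]_n) : `|dot u v| <= enorm u * enorm v.
Proof.
have [v0|v0] := eqVneq (enorm v) 0.
  rewrite (enorm0_eq v0) -[X in dot u X](scale0r 0) dotZr mul0r normr0.
  by rewrite mulr_ge0 ?enorm_ge0.
rewrite -ler_sqr ?nnegrE ?mulr_ge0 ?enorm_ge0// real_normK ?num_real//.
rewrite exprMn.
have := dot_ge0 (enorm v ^+ 2 *: u - dot u v *: v).
rewrite -scaleNr !(dotDl, dotDr, dotZl, dotZr) (dotC v u) -!sqr_enorm.
have v2 : 0 < enorm v ^+ 2 by rewrite exprn_even_gt0.
move: (enorm v ^+ 2) v2 (enorm u ^+ 2) (dot u v) => a a0 b c.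
rewrite [X in 0 <= X -> _](_ : _ = a * (b * a - c ^+ 2)); last by ring.
by rewrite pmulr_rge0// subr_ge0.
Qed.

Lemma enormD n (u v : 'cV[R]_n) : enorm (u + v) <= enorm u + enorm v.
Proof.
rewrite -ler_sqr ?nnegrE ?addr_ge0 ?enorm_ge0// sqrrD !sqr_enorm.
rewrite !(dotDl, dotDr) (dotC v u).
have := le_trans (ler_norm _) (normr_dot u v).
by move: (dot u v) (enorm u * enorm v) => a b ab; lra.
Qed.

Lemma enorm_dist_le n (u v : 'cV[R]_n) : enorm (u - v) <= enorm u + enorm v.
Proof. by rewrite (le_trans (enormD _ _))// enormN. Qed.

Lemma dot_col_mx n1 n2 (u u' : 'cV[R]_n1) (v v' : 'cV[R]_n2) :
  dot (col_mx u v) (col_mx u' v') = dot u u' + dot v v'.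
Proof.
rewrite /dot big_split_ord /=.
by congr (_ + _); apply: eq_bigr => i _; rewrite ?col_mxEu ?col_mxEd.
Qed.

Lemma dot0l n (u : 'cV[R]_n) : dot 0 u = 0.
Proof. by rewrite -(scale0r 0) dotZl mul0r. Qed.

Lemma enorm_col_mx0 n1 n2 (u : 'cV[R]_n1) :
  enorm (col_mx u (0 : 'cV_n2)) = enorm u.
Proof. by rewrite !enormE dot_col_mx dot0l addr0. Qed.

Lemma enorm_col_0mx n1 n2 (u : 'cV[R]_n2) :
  enorm (col_mx (0 : 'cV_n1) u) = enorm u.
Proof. by rewrite !enormE dot_col_mx dot0l add0r. Qed.

Lemma enorm_col_mx_geu n1 n2 (u : 'cV[R]_n1) (v : 'cV_n2) :
  enorm u <= enorm (col_mx u v).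
Proof. by rewrite !enormE ler_wsqrtr// dot_col_mx lerDl dot_ge0. Qed.

Lemma enorm_col_mx_ged n1 n2 (u : 'cV[R]_n1) (v : 'cV_n2) :
  enorm v <= enorm (col_mx u v).
Proof. by rewrite !enormE ler_wsqrtr// dot_col_mx lerDr dot_ge0. Qed.

Lemma enorm_mulmx m n (A : 'M[R]_(m, n)) (x : 'cV[R]_n) :
  enorm (A *m x) <= Num.sqrt (\sum_i enorm (row i A)^T ^+ 2) * enorm x.
Proof.
rewrite -ler_sqr ?nnegrE ?mulr_ge0 ?sqrtr_ge0// exprMn.
have S0 : 0 <= \sum_i enorm (row i A)^T ^+ 2.
  by apply: sumr_ge0 => i _; exact: sqr_ge0.
rewrite (sqr_sqrtr S0).
rewrite [X in X <= _]sqr_enorm /dot mulr_suml; apply: ler_sum => i _.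
rewrite -expr2 -exprMn -real_normK ?num_real//.
rewrite ler_sqr ?nnegrE ?mulr_ge0 ?enorm_ge0//.
rewrite (_ : (A *m x) i 0 = dot (row i A)^T x) ?normr_dot//.
by rewrite mxE; apply: eq_bigr => j _; rewrite !mxE.
Qed.

Lemma opnorm_mulmx m n (A : 'M[R]_(m, n)) (x : 'cV[R]_n) :
  enorm (A *m x) <= opnorm A * enorm x.
Proof.
have [x0|x0] := eqVneq (enorm x) 0.
  by rewrite x0 mulr0 (le_trans (enorm_mulmx _ _))// x0 mulr0.
have xgt0 : 0 < enorm x by rewrite lt_neqAle eq_sym x0 enorm_ge0.
rewrite -ler_pdivrMr//.
have -> : enorm (A *m x) / enorm x = enorm (A *m ((enorm x)^-1 *: x)).
  by rewrite -scalemxAr enormZ mulrC ger0_norm// invr_ge0 ltW.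
apply: ub_le_sup.
  exists (Num.sqrt (\sum_i enorm (row i A)^T ^+ 2)) => _ [y /= y1 <-].
  by rewrite (le_trans (enorm_mulmx _ _))// ler_piMr ?sqrtr_ge0.
exists ((enorm x)^-1 *: x) => //=.
by rewrite enormZ ger0_norm ?invr_ge0 ?enorm_ge0// mulVf.
Qed.

End Euclid.
Section Calculus.
Variables (R : realType) (m : nat).
Implicit Types (f : 'cV[R]_m -> R) (p q u v w : 'cV[R]_m).

Lemma is_derive_grad f p v :
    (forall i, has_partial i f /\ continuous (partial i f)) ->
  is_derive p v f (dot v (grad f p)).
Proof.
move=> C1.
have -> : v = \sum_i v i 0 *: delta_mx i 0.
  by rewrite [LHS]matrix_sum_delta; apply: eq_bigr => i _; rewrite big_ord1.
have -> : dot (\sum_i v i 0 *: delta_mx i 0) (grad f p) =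
          \sum_i v i 0 * partial i f p.
  rewrite [X in dot X _](_ : _ = v); last first.
    by rewrite [RHS]matrix_sum_delta; apply: eq_bigr => i _; rewrite big_ord1.
  by apply: eq_bigr => i _; rewrite mxE.
elim/big_rec2: _ => [|i D w _ dw].
  suff : is_derive (p + (0 : R) *: (0 : 'cV[R]_m)) 0 f 0.
    by rewrite scale0r addr0.
  apply/is_derive_line.
  rewrite (_ : (fun _ => _) = cst (f p)); first exact: is_derive_cst.
  by apply/funext => r; rewrite scaler0 addr0.
have [dp cp] := C1 i.
have E q : 'D_(v i 0 *: delta_mx i 0) f q = v i 0 * partial i f q.
  by have [_ ->] := is_derive_scale (v i 0) (derivableP (dp q)).
rewrite (addrC (v i 0 *: _) w) (addrC (v i 0 * _) D) -(E p).
apply: (@is_deriveDv _ _ f p w (v i 0 *: delta_mx i 0) D dw).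
  by move=> q; have [] := is_derive_scale (v i 0) (derivableP (dp q)).
move/funext: E => ->.
exact: (@cvgM _ _ (nbhs p) _ (cst (v i 0)) _ _ _ (cvg_cst _) (cp p)).
Qed.

Lemma is_derive_dir2 f p v w : C2 f ->
  is_derive p w ('D_v f) (dot w (hessian f p *m v)).
Proof.
move=> [C1 C2f].
have -> : 'D_v f = \sum_(i < m) (fun q => v i 0 * partial i f q).
  apply/funext => q; have [_ ->] := is_derive_grad q v C1.
  by rewrite fct_sumE; apply: eq_bigr => i _; rewrite mxE.
have -> : dot w (hessian f p *m v) =
    \sum_(i < m) v i 0 * dot w (grad (partial i f) p).
  rewrite /dot; under eq_bigr do rewrite mxE mulr_sumr.
  rewrite exchange_big; apply: eq_bigr => j _; rewrite mulr_sumr.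
  by apply: eq_bigr => i _; rewrite !mxE; ring.
apply: is_derive_sum => i.
apply: (@is_deriveZ _ _ _ (partial i f) (v i 0)).
by apply: is_derive_grad => j; exact: C2f.
Qed.

Lemma second_difference f p v w : C2 f ->
  exists q, f (p + v + w) - f (p + v) - (f (p + w) - f p) =
            dot w (hessian f q *m v).
Proof.
move=> C2f; pose F := fun q => f (q + w) - f q.
have dF q : is_derive q v F ('D_v f (q + w) - 'D_v f q).
  have d q' : derivable f q' v by have [] := is_derive_grad q' v C2f.1.
  apply: (@is_deriveB _ _ _ (fun q => f (q + w)) f); last exact: derivableP.
  by apply: is_derive_shift; exact: derivableP.
have [q|s _] := @MVT_line _ _ F p v; first by have [] := dF q.
have [_ ->] := dF (p + s *: v).
have [q|r _ ->] := @MVT_line _ _ ('D_v f) (p + s *: v) w.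
  by have [] := is_derive_dir2 q v w C2f.
have [_ ->] := is_derive_dir2 (p + s *: v + r *: w) v w C2f.
by rewrite /F => ->; exists (p + s *: v + r *: w).
Qed.

Lemma grad_argmin f p : (forall i, has_partial i f /\ continuous (partial i f)) ->
  is_argmin f p -> grad f p = 0.
Proof.
move=> C1 pmin; apply/colP => i; rewrite !mxE.
have [dp _] := C1 i.
have d (s : R) : is_derive s 1 (fun r : R => f (p + r *: delta_mx i 0))
    (partial i f (p + s *: delta_mx i 0)).
  exact: (is_derive_line _ _ _ _ _).1 (derivableP (dp _)).
have min0 (t : R) : t \in `]-1, 1[%R ->
    f (p + (0 : R) *: delta_mx i 0) <= f (p + t *: delta_mx i 0).
  by move=> _; rewrite scale0r addr0; exact: pmin.
have ab : -1 <= (1 : R) by lra.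
have d' (t : R) : t \in `]-1, 1[%R ->
    derivable (fun r : R => f (p + r *: delta_mx i 0)) t 1.
  by move=> _; have [] := d t.
have c0 : (0 : R) \in `]-1, 1[%R by rewrite in_itv/=; lra.
have [_] := derive1_at_min ab d' c0 min0.
by have [_ ->] := d 0; rewrite scale0r addr0.
Qed.

Lemma smooth_growth f (L : R) p q :
    (forall i, has_partial i f /\ continuous (partial i f)) ->
    (forall p q, enorm (grad f p - grad f q) <= L * enorm (p - q)) ->
    is_argmin f p ->
  f q - f p <= L * enorm (q - p) ^+ 2.
Proof.
move=> C1 Lip pmin.
have [r|s /andP[s0 s1]] := @MVT_line _ _ f p (q - p).
  by have [] := is_derive_grad r (q - p) C1.
rewrite [p + _]addrC subrK => ->.
have [_ ->] := is_derive_grad (p + s *: (q - p)) (q - p) C1.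
rewrite (le_trans (ler_norm _))// (le_trans (normr_dot _ _))//.
have := Lip (p + s *: (q - p)) p.
rewrite (grad_argmin C1 pmin) subr0 addrAC subrr add0r enormZ ger0_norm// => H.
rewrite expr2 mulrCA ler_wpM2l ?enorm_ge0//.
have [q0|q0] := eqVneq (enorm (q - p)) 0.
  by move: H; rewrite q0 !mulr0.
have L0 : 0 <= L.
  have qgt0 : 0 < enorm (q - p) by rewrite lt_neqAle eq_sym q0 enorm_ge0.
  by have := le_trans (enorm_ge0 _) (Lip q p); rewrite pmulr_lge0.
rewrite (le_trans H)// ler_wpM2l// ler_piMl ?enorm_ge0//.
Qed.

Lemma strongly_convex_growth f (mu : R) p q :
  strongly_convex mu f -> is_argmin f p ->
  mu / 2 * enorm (q - p) ^+ 2 <= f q - f p.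
Proof.
move=> sc pmin; set X := mu / 2 * _; set D := f q - f p.
have H (a : R) : 0 < a <= 1 -> (1 - a) * X <= D.
  case/andP=> a0 a1.
  have := le_trans (pmin _) (sc q p a _); rewrite (ltW a0) a1 => /(_ isT).
  rewrite -subr_ge0 [X in 0 <= X -> _](_ : _ = a * (D - (1 - a) * X)).
    by rewrite pmulr_rge0// subr_ge0.
  by rewrite /D /X; ring.
rewrite leNgt; apply/negP => DX.
have D0 : 0 <= D by rewrite subr_ge0.
have X0 : 0 < X by rewrite (le_lt_trans D0).
have /H : 0 < (X - D) / (2 * X) <= 1.
  apply/andP; split; first by apply: divr_gt0; lra.
  by rewrite ler_pdivrMr; lra.
rewrite mulrBl mul1r (_ : (X - D) / (2 * X) * X = (X - D) / 2); last first.
  by field; rewrite gt_eqF.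
lra.
Qed.

End Calculus.
Section Rows.
Variables (R : realType) (n : nat).
Implicit Types (g : 'cV[R]_(n + n) -> R) (u v : 'cV[R]_n).

Definition cross g u u' v v' : R :=
  g (col_mx u' v') - g (col_mx u' v) - (g (col_mx u v') - g (col_mx u v)).

Lemma normr_cross g (e : R) u u' v v' : C2 g ->
    (forall p, opnorm (dlsubmx (hessian g p)) <= e) ->
  `|cross g u u' v v'| <= e * enorm (u' - u) * enorm (v' - v).
Proof.
move=> C2g He; rewrite /cross.
have [q] := second_difference (col_mx u v) (col_mx (u' - u) 0)
  (col_mx 0 (v' - v)) C2g.
rewrite !add_col_mx !addr0 ![u + _]addrC ![v + _]addrC !subrK => ->.
rewrite -[hessian g q]submxK mul_block_col dot_col_mx dot0l add0r mulmx0 addr0.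
rewrite (le_trans (normr_dot _ _))// mulrC ler_wpM2r ?enorm_ge0//.
by rewrite (le_trans (opnorm_mulmx _ _))// ler_wpM2r ?enorm_ge0// He.
Qed.

Lemma strongly_convexD m (a b : R) (g h : 'cV[R]_m -> R) :
  strongly_convex a g -> strongly_convex b h -> strongly_convex (a + b) (g \+ h).
Proof.
move=> cg ch p q c c01; have := lerD (cg p q c c01) (ch p q c c01).
move=> /le_trans; apply; rewrite le_eqVlt; apply/orP; left.
by apply/eqP => /=; field.
Qed.

Lemma strongly_convex_sliced (a : R) g u :
  strongly_convex a g -> strongly_convex a (fun y => g (col_mx u y)).
Proof.
move=> cg p q c c01; have := cg (col_mx u p) (col_mx u q) c c01.
rewrite !scale_col_mx !add_col_mx -scalerDl [c + _]addrC subrK scale1r.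
by rewrite opp_col_mx add_col_mx subrr enorm_col_0mx.
Qed.

Lemma strongly_convex_sliceu (a : R) g v :
  strongly_convex a g -> strongly_convex a (fun y => g (col_mx y v)).
Proof.
move=> cg p q c c01; have := cg (col_mx p v) (col_mx q v) c c01.
rewrite !scale_col_mx !add_col_mx -scalerDl [c + _]addrC subrK scale1r.
by rewrite opp_col_mx add_col_mx subrr enorm_col_mx0.
Qed.

Lemma argmin_sqdist m (a : R) (g h : 'cV[R]_m -> R) p q :
    strongly_convex a g -> strongly_convex a h -> is_argmin g p ->
    is_argmin h q ->
  a * enorm (p - q) ^+ 2 <= g q - g p + (h p - h q).
Proof.
move=> cg ch gp hq.
have := lerD (strongly_convex_growth q cg gp) (strongly_convex_growth p ch hq).
by rewrite enormB -mulrDl -splitr.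
Qed.
End Rows.
Section Decay.
Variable R : realType.

(* Eliminating forwards from l turns the recursion into
   3 a_s <= c 3^-(s - l - 1) + a_(s + 1); 9/8 is the sum of the powers of 1/9. *)
Lemma decay (a : nat -> R) (c : R) l T :
    0 <= c -> (forall s, 0 <= a s) -> a l <= c + a l.+1 / 2 ->
    (forall s, (l < s < T)%N -> 4 * a s <= a s.-1 + a s.+1) ->
  forall j k, T = ((l + k).+1 + j)%N ->
    a (l + k).+1 <= 9 / 8 * c * 3^-1 ^+ k.+1 + 3^-1 ^+ j * a T.
Proof.
move=> c0 a0 al rec.
have fwd k : ((l + k).+1 < T)%N ->
    3 * a (l + k).+1 <= c * 3^-1 ^+ k + a (l + k).+2.
  elim: k => [|k IH] kT.
    have /= := rec (l + 0).+1; rewrite kT addn0 ltnSn => /(_ isT).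
    by have := a0 l.+1; rewrite expr0; lra.
  have := IH (ltnW _); rewrite -addnS => /(_ kT).
  have := rec (l + k.+1).+1; rewrite kT ltnS leq_addr => /(_ isT) /=.
  by have := a0 (l + k.+1).+1; rewrite exprSr; lra.
elim=> [|j IH] k TE.
  by rewrite expr0 mul1r TE addn0 lerDr !mulr_ge0// exprn_ge0// invr_ge0.
have := fwd k; rewrite {1}TE -addSnnS leq_addr => /(_ isT).
have := IH k.+1; rewrite addnS TE -addSnnS => /(_ erefl).
by rewrite !exprSr; lra.
Qed.

Lemma decay0 (a : nat -> R) T :
    (0 < T)%N -> (forall s, 0 <= a s) -> 2 * a 0 <= a 1 ->
    (forall s, (0 < s < T)%N -> 4 * a s <= a s.-1 + a s.+1) ->
  forall t, (t <= T)%N -> a t <= 3 / 2 * 3^-1 ^+ (T - t) * a T.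
Proof.
move=> T0 a0 a01 rec.
have a0' : a 0 <= 0 + a 1 / 2 by lra.
have pos k : 0 <= 3^-1 ^+ k * a T :> R.
  by rewrite mulr_ge0// exprn_ge0// invr_ge0.
have H := decay (lexx 0) a0 a0' rec.
case=> [|t] tT.
  have := H T.-1 0; rewrite subn0 add0n mulr0 mul0r add0r.
  have -> : T = (1 + T.-1)%N by lia.
  by move=> /(_ erefl); rewrite addSn exprSr add0n /=; lra.
have := H (T - t.+1)%N t; rewrite mulr0 mul0r !add0n add0r subnKC//.
by move=> /(_ erefl) /le_trans; apply; have := pos (T - t.+1)%N; lra.
Qed.
End Decay.

Section Limits.
Variables (R : realType) (n : nat).
Implicit Types (x : nat -> 'cV[R]_n) (v w : 'cV[R]_n).

Lemma normr_le_enorm v : `|v| <= enorm v.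
Proof.
have [->|v0] := eqVneq `|v| 0; first exact: enorm_ge0.
have [[i j] /= E] := mx_norm_neq0 v0.
rewrite [`|v|]E ord1 -sqrtr_sqr ler_wsqrtr// (bigD1 i)//= lerDl.
by apply: sumr_ge0 => k _; exact: sqr_ge0.
Qed.

Lemma enorm_le_normr v : enorm v <= n%:R * `|v|.
Proof.
rewrite -[n%:R * _]ger0_norm ?mulr_ge0// -sqrtr_sqr ler_wsqrtr//.
have vi i : v i 0 ^+ 2 <= `|v| ^+ 2.
  rewrite -real_normK ?num_real// ler_sqr ?nnegrE//.
  rewrite [leRHS]mx_normrE.
  exact: (le_bigmax _ (fun ij : 'I_n * 'I_1 => `|v ij.1 ij.2|) (i, 0)).
apply: (@le_trans _ _ (\sum_(i < n) `|v| ^+ 2)); first exact: ler_sum.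
rewrite sumr_const card_ord exprMn -[leLHS]mulr_natl ler_wpM2r ?sqr_ge0//.
by rewrite -natrX ler_nat; nia.
Qed.

Lemma enorm_cauchy_cvg x (C : R) t :
    (forall N N', (t <= N <= N')%N ->
      enorm (x N - x N') <= C * 3^-1 ^+ (N - t)) ->
  cvg (x N @[N --> \oo]).
Proof.
move=> xC; apply/cauchy_cvgP/cauchy_exP => e e0.
have : C * 3^-1 ^+ k @[k --> \oo] --> C * 0.
  apply: cvgM; first exact: cvg_cst.
  by apply: cvg_expr; rewrite ger0_norm ?invr_ge0// invf_lt1 ?ltr1n.
rewrite mulr0 => /cvgrPdist_lt/(_ _ e0)[k _ /(_ k (leqnn k))].
rewrite sub0r normrN => ke.
exists (x (k + t)%N), (k + t)%N => // N /= kN.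
rewrite -ball_normE/= (le_lt_trans (normr_le_enorm _))//.
have := xC (k + t)%N N; rewrite leq_addl addnK => /(_ kN)/le_lt_trans; apply.
exact: le_lt_trans (ler_norm _) ke.
Qed.

Lemma enorm_lim_le x w (C : R) N0 : cvg (x N @[N --> \oo]) ->
    (forall N, (N0 <= N)%N -> enorm (x N - w) <= C) ->
  enorm (lim (x N @[N --> \oo]) - w) <= C.
Proof.
move=> cx xC; apply/ler_addgt0Pr => e e0.
have /cvgrPdist_lt/(_ (e / n.+1%:R)) : x N @[N --> \oo] --> lim (x N @[N --> \oo]).
  exact: cx.
rewrite divr_gt0// => /(_ isT)[N1 _ H].
have {H}/= := H (maxn N0 N1) (leq_maxr _ _).
set N := maxn _ _; set l := lim _ => lN.
rewrite -[l - w](subrK (x N - w)) addrC (le_trans (enormD _ _))// lerD//.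
  by rewrite xC// leq_maxl.
rewrite opprB addrA subrK (le_trans (enorm_le_normr _))//.
rewrite (@le_trans _ _ (n.+1%:R * `|l - x N|))// ?ler_wpM2r// ?ler_nat//.
by rewrite mulrC -ler_pdivlMr// ltW.
Qed.
End Limits.

Section Streaming.
Variables (R : realType) (n : nat) (f : nat -> 'cV[R]_(n + n) -> R).
Implicit Types (x z : nat -> 'cV[R]_n) (y : 'cV[R]_n).

(* With z_l frozen this is the truncated cost, see trunc_costE. *)
Definition path_cost l T x : R :=
  \sum_(l.+1 <= t < T.+1) f t (col_mx (x t.-1) (x t)).

Definition row_cost T x t y : R :=
  (if (0 < t)%N then f t (col_mx (x t.-1) y) else 0) +
  (if (t < T)%N then f t.+1 (col_mx y (x t.+1)) else 0).

Definition row_opt T x t : Prop := is_argmin (row_cost T x t) (x t).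

Definition update x t y : nat -> 'cV[R]_n := fun s => if s == t then y else x s.

Lemma path_cost_update l T x t y : (l < t <= T)%N \/ t = l /\ t = 0 ->
  path_cost l T (update x t y) - path_cost l T x =
  row_cost T x t y - row_cost T x t (x t).
Proof.
move=> lt; rewrite /path_cost -sumrB.
pose A := f t (col_mx (x t.-1) y) - f t (col_mx (x t.-1) (x t)).
pose B := f t.+1 (col_mx y (x t.+1)) - f t.+1 (col_mx (x t) (x t.+1)).
rewrite (@eq_big_nat _ _ _ _ _ _
  (fun s => (if s == t then A else 0) + (if s == t.+1 then B else 0))).
  rewrite big_split /= -!big_mkcond !big_nat1_eq /row_cost.
  have -> : (l < t < T.+1)%N = (0 < t)%N by lia.
  have -> : (l < t.+1 < T.+1)%N = (t < T)%N by lia.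
  by rewrite /A /B; case: ifP => _; case: ifP => _; ring.
move=> s sl; rewrite /update; have -> : (s.-1 == t) = (s == t.+1) by lia.
case: (eqVneq s t) => [st|st].
  by rewrite st (ltn_eqF (ltnSn t)) addr0.
case: (eqVneq s t.+1) => [->|_]; first by rewrite /B add0r.
by rewrite addr0 subrr.
Qed.

Lemma argmin_J_row_opt T x t : is_argmin (J f T) x -> (t <= T)%N ->
  row_opt T x t.
Proof.
move=> xmin tT y; rewrite -subr_ge0 -(@path_cost_update 0); last by lia.
by rewrite subr_ge0; exact: xmin.
Qed.

Lemma trunc_costE B T z : (0 < B <= T)%N ->
  trunc_cost f B T (z (T - B)%N) z = path_cost (T - B) T z.
Proof. by move=> BT; rewrite /path_cost big_ltn//; lia. Qed.

Lemma argmin_trunc_row_opt B T z t : (0 < B <= T)%N ->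
    is_argmin (trunc_cost f B T (z (T - B)%N)) z -> (T - B < t <= T)%N ->
  row_opt T z t.
Proof.
move=> BT zmin tT y; rewrite -subr_ge0 -(@path_cost_update (T - B)); last by lia.
have zT : update z t y (T - B) = z (T - B)%N.
  by rewrite /update; case: eqVneq => // ?; lia.
by rewrite subr_ge0 -!trunc_costE// zT; exact: zmin.
Qed.

Variables (mu L M : R) (xbar : nat -> 'cV[R]_(n + n)).
Hypotheses (mu_gt0 : 0 < mu) (muL : mu <= L).
Hypothesis sc : forall t, (0 < t)%N -> strongly_convex mu (f t).
Hypothesis crs : forall t u u' v v', (0 < t)%N ->
  `|cross (f t) u u' v v'| <= mu / 2 * enorm (u' - u) * enorm (v' - v).
Hypothesis grow : forall t q, (0 < t)%N ->
  f t q - f t (xbar t) <= L * enorm (q - xbar t) ^+ 2.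
Hypothesis xbar_min : forall t, (0 < t)%N -> is_argmin (f t) (xbar t).
Hypothesis xbar_le : forall t, (0 < t)%N -> enorm (xbar t) <= M.

Lemma row_interior Tx Tz x z t : (0 < t < Tx)%N -> (t < Tz)%N ->
    row_opt Tx x t -> row_opt Tz z t ->
  4 * enorm (x t - z t) <=
    enorm (x t.-1 - z t.-1) + enorm (x t.+1 - z t.+1).
Proof.
move=> /andP[t0 tx] tz ox oz.
have E T w y : (t < T)%N -> row_cost T w t y =
    f t (col_mx (w t.-1) y) + f t.+1 (col_mx y (w t.+1)).
  by move=> tT; rewrite /row_cost t0 tT.
have C T w : (t < T)%N -> strongly_convex (mu + mu) (row_cost T w t).
  move=> tT; rewrite (_ : row_cost T w t = (fun y => f t (col_mx (w t.-1) y))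
    \+ (fun y => f t.+1 (col_mx y (w t.+1)))); last first.
    by apply/funext => y; exact: E.
  by apply: strongly_convexD; [exact/strongly_convex_sliced/sc
                              |exact/strongly_convex_sliceu/sc].
have := argmin_sqdist (C _ _ tx) (C _ _ tz) ox oz.
rewrite !E//.
have := crs (x t.-1) (z t.-1) (x t) (z t) t0.
have := crs (x t) (z t) (x t.+1) (z t.+1) (ltn0Sn t).
rewrite !(enormB (z _)) !ler_norml /cross => /andP[c1 _] /andP[c2 _] D.
have [-> //|a0] := eqVneq (enorm (x t - z t)) 0.
  by rewrite mulr0 addr_ge0 ?enorm_ge0.
have agt0 : 0 < enorm (x t - z t) by rewrite lt_neqAle eq_sym a0 enorm_ge0.
rewrite -(ler_pM2l (mulr_gt0 mu_gt0 agt0)).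
by move: c1 c2 D; set a := enorm _; lra.
Qed.

Lemma row_first Tx Tz x z : (0 < Tx)%N -> (0 < Tz)%N ->
    row_opt Tx x 0 -> row_opt Tz z 0 ->
  2 * enorm (x 0 - z 0) <= enorm (x 1 - z 1).
Proof.
move=> tx tz ox oz.
have E T w : (0 < T)%N ->
    row_cost T w 0 = fun y => f 1 (col_mx y (w 1)).
  by move=> tT; apply/funext => y; rewrite /row_cost/= tT add0r.
have C T w : (0 < T)%N -> strongly_convex mu (row_cost T w 0).
  by move=> tT; rewrite E//; exact/strongly_convex_sliceu/sc.
have := argmin_sqdist (C _ _ tx) (C _ _ tz) ox oz.
rewrite !E//.
have := crs (x 0) (z 0) (x 1) (z 1) (ltn0Sn 0).
rewrite !(enormB (z _)) !ler_norml /cross => /andP[c1 _] D.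
have [->|a0] := eqVneq (enorm (x 0 - z 0)) 0; first by rewrite mulr0 enorm_ge0.
have agt0 : 0 < enorm (x 0 - z 0) by rewrite lt_neqAle eq_sym a0 enorm_ge0.
rewrite -(ler_pM2l (mulr_gt0 mu_gt0 agt0)).
by move: c1 D; set a := enorm _; lra.
Qed.

Let barl t := usubmx (xbar t).
Let barr t := dsubmx (xbar t).

Let xbarE t : xbar t = col_mx (barl t) (barr t).
Proof. by rewrite vsubmxK. Qed.

Let barl_le t : (0 < t)%N -> enorm (barl t) <= M.
Proof.
move=> /xbar_le; rewrite xbarE; apply: le_trans; exact: enorm_col_mx_geu.
Qed.

Let barr_le t : (0 < t)%N -> enorm (barr t) <= M.
Proof.
move=> /xbar_le; rewrite xbarE; apply: le_trans; exact: enorm_col_mx_ged.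
Qed.

Let barl_min t : (0 < t)%N -> is_argmin (fun y => f t (col_mx y (barr t))) (barl t).
Proof. by move=> t0 y; rewrite -xbarE; exact: xbar_min. Qed.

Let barr_min t : (0 < t)%N -> is_argmin (fun y => f t (col_mx (barl t) y)) (barr t).
Proof. by move=> t0 y; rewrite -xbarE; exact: xbar_min. Qed.

Definition frame_bound : R := (5 + 8 * (L / mu)) * M.

Let M_ge0 : 0 <= M.
Proof. exact: le_trans (enorm_ge0 _) (xbar_le (ltn0Sn 0)). Qed.

Let LV : 1 <= L / mu.
Proof. by rewrite ler_pdivlMr// mul1r. Qed.

Let le_frame_bound b : b <= 3 * M -> b <= frame_bound.
Proof.
move=> h; rewrite /frame_bound (le_trans h)// ler_wpM2r//.
by have := LV; lra.
Qed.

Let end_bound (X Z b : R) : 0 <= X -> mu * X ^+ 2 <= mu / 2 * X * Z ->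
  Z <= b + M -> b <= X + M -> b <= frame_bound.
Proof.
move=> X0 XZ Zb bX; apply: le_frame_bound.
have [X_0|Xn0] := eqVneq X 0; first by move: M_ge0 bX; rewrite X_0; lra.
have Xgt0 : 0 < X by rewrite lt_neqAle eq_sym Xn0.
have : 2 * X <= Z; last by lra.
rewrite -(ler_pM2l (mulr_gt0 mu_gt0 Xgt0)).
by move: XZ; lra.
Qed.

(* X, Y, Z are the distances of frame t and of its two neighbours to the isolated
   minimizers, and b is the largest frame norm. *)
Let interior_bound (X Y Z b : R) : 0 <= X ->
  3 / 2 * mu * X ^+ 2 <= mu / 2 * X * (Y + Z) + 4 * L * M ^+ 2 ->
  Y <= b + M -> Z <= b + M -> b <= X + M -> b <= frame_bound.
Proof.
move=> X0 XYZ Yb Zb bX; suff : X <= (4 + 8 * (L / mu)) * M.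
  by rewrite /frame_bound; lra.
have h : 3 / 2 * X ^+ 2 <= X * (X + 2 * M) + 4 * (L / mu) * M ^+ 2.
  rewrite -(ler_pM2l mu_gt0).
  have -> : mu * (X * (X + 2 * M) + 4 * (L / mu) * M ^+ 2) =
            mu * (X * (X + 2 * M)) + 4 * L * M ^+ 2.
    by field; rewrite gt_eqF.
  have : mu * (X * (Y + Z)) <= mu * (X * (2 * X + 4 * M)).
    by rewrite ler_wpM2l ?(ltW mu_gt0)// ler_wpM2l//; lra.
  by lra.
rewrite leNgt; apply/negP; move: (L / mu) LV h => V V1 h ltX.
have VM : 0 <= V * M by rewrite mulr_ge0//; lra.
have Xgt0 : 0 < X by apply: le_lt_trans ltX; have := M_ge0; lra.
have h2 : (4 + 8 * V) * M * X <= X * X by rewrite ler_wpM2r// ltW.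
have [M0|Mn0] := eqVneq M 0.
  by move: h (mulr_gt0 Xgt0 Xgt0); rewrite M0; lra.
have Mgt0 : 0 < M by rewrite lt_neqAle eq_sym Mn0 M_ge0.
have VMgt0 : 0 < V * M by rewrite mulr_gt0//; lra.
have : V * M * X <= V * M * M by move: h h2; lra.
by rewrite ler_pM2l//; lra.
Qed.

Let triM (u v : 'cV[R]_n) b : enorm u <= b -> enorm v <= M ->
  enorm (u - v) <= b + M.
Proof. by move=> ub vM; rewrite (le_trans (enorm_dist_le _ _))// lerD. Qed.

Let subM (u v : 'cV[R]_n) : enorm v <= M -> enorm u <= enorm (u - v) + M.
Proof.
move=> vM; rewrite -{1}(subrK v u) (le_trans (enormD _ _))// lerD//.
Qed.

Lemma row_le_first T x : (0 < T)%N -> row_opt T x 0 ->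
  enorm (x 1) <= enorm (x 0) -> enorm (x 0) <= frame_bound.
Proof.
move=> T0 ox x10.
have E : row_cost T x 0 = fun y => f 1 (col_mx y (x 1)).
  by apply/funext => y; rewrite /row_cost/= T0 add0r.
rewrite /row_opt E in ox.
have := argmin_sqdist (strongly_convex_sliceu (x 1) (sc (ltn0Sn 0)))
  (strongly_convex_sliceu (barr 1) (sc (ltn0Sn 0))) ox (barl_min (ltn0Sn 0)).
have := crs (x 0) (barl 1) (x 1) (barr 1) (ltn0Sn 0).
rewrite (enormB (barl 1)) (enormB (barr 1)).
rewrite ler_norml /cross => /andP[c1 _] D.
apply: (end_bound _ _ (triM x10 (barr_le (ltn0Sn 0)))
  (subM _ (barl_le (ltn0Sn 0)))).
  exact: enorm_ge0.
by move: c1 D; lra.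
Qed.

Lemma row_le_last T x : (0 < T)%N -> row_opt T x T ->
  enorm (x T.-1) <= enorm (x T) -> enorm (x T) <= frame_bound.
Proof.
move=> T0 ox xT.
have E : row_cost T x T = fun y => f T (col_mx (x T.-1) y).
  by apply/funext => y; rewrite /row_cost/= T0 ltnn addr0.
rewrite /row_opt E in ox.
have := argmin_sqdist (strongly_convex_sliced (x T.-1) (sc T0))
  (strongly_convex_sliced (barl T) (sc T0)) ox (barr_min T0).
have := crs (x T.-1) (barl T) (x T) (barr T) T0.
rewrite (enormB (barl T)) (enormB (barr T)).
rewrite ler_norml /cross => /andP[c1 _] D.
apply: (end_bound _ _ (triM xT (barl_le T0)) (subM _ (barr_le T0))).
  exact: enorm_ge0.
by move: c1 D; lra.
Qed.

Lemma row_le_interior T x t : (0 < t < T)%N -> row_opt T x t ->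
    enorm (x t.-1) <= enorm (x t) -> enorm (x t.+1) <= enorm (x t) ->
  enorm (x t) <= frame_bound.
Proof.
move=> /andP[t0 tT] ox xl xr.
have E : row_cost T x t = (fun y => f t (col_mx (x t.-1) y))
    \+ (fun y => f t.+1 (col_mx y (x t.+1))).
  by apply/funext => y; rewrite /row_cost t0 tT.
rewrite /row_opt E in ox.
have D1 := strongly_convex_growth (barr t) (strongly_convexD
  (strongly_convex_sliced (x t.-1) (sc t0))
  (strongly_convex_sliceu (x t.+1) (sc (ltn0Sn t)))) ox.
have D2 := strongly_convex_growth (x t)
  (strongly_convex_sliced (barl t) (sc t0)) (barr_min t0).
have D3 := barl_min (ltn0Sn t) (x t).
have D4 := grow (col_mx (barr t) (barr t.+1)) (ltn0Sn t).
rewrite xbarE opp_col_mx add_col_mx subrr in D4.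
rewrite enorm_col_mx0 in D4.
have D5 : L * enorm (barr t - barl t.+1) ^+ 2 <= 4 * L * M ^+ 2.
  rewrite (_ : 4 * L * M ^+ 2 = L * (M + M) ^+ 2); last by ring.
  rewrite ler_wpM2l ?(le_trans (ltW mu_gt0) muL)//.
  rewrite ler_sqr ?nnegrE ?enorm_ge0 ?addr_ge0//.
  by apply: triM; [exact: barr_le|exact: barl_le].
have := crs (x t.-1) (barl t) (x t) (barr t) t0.
have := crs (x t) (barr t) (x t.+1) (barr t.+1) (ltn0Sn t).
rewrite (enormB (barl t)) !(enormB (barr _) (x _)).
rewrite !ler_norml /cross => /andP[c1 _] /andP[c2 _].
apply: (interior_bound _ _ (triM xl (barl_le t0))
  (triM xr (barr_le (ltn0Sn t))) (subM _ (barr_le t0))); first exact: enorm_ge0.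
rewrite (enormB (barr t) (x t)) in D1.
move: c1 c2 D1 D2 D3 D4 D5 => /=.
by lra.
Qed.

Lemma frames_le l T x : (l < T)%N ->
    (l = 0 /\ row_opt T x 0 \/ enorm (x l) <= frame_bound) ->
    (forall t, (l < t <= T)%N -> row_opt T x t) ->
  forall t, (l <= t <= T)%N -> enorm (x t) <= frame_bound.
Proof.
move=> lT xl ox.
have [s slT smax] : exists2 s, (l <= s <= T)%N &
    forall t, (l <= t <= T)%N -> enorm (x t) <= enorm (x s).
  have lP : (l <= (Ordinal (leqnn T.+1) : 'I_T.+1))%N by exact: ltnW.
  case: (@arg_maxP _ _ _ _ (fun i : 'I_T.+1 => (l <= i)%N)
    (fun i => enorm (x i)) lP) => i li imax.
  exists i; first by rewrite li -ltnS ltn_ord.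
  move=> t /andP[lt tT].
  have tT' : (t < T.+1)%N by [].
  exact: (imax (Ordinal tT')).
suff : enorm (x s) <= frame_bound by move=> h t /smax /le_trans; exact.
have [sl|sl] := eqVneq s l.
  rewrite sl; rewrite sl in slT smax; case: xl => // -[l0 ox0].
  rewrite l0 in lT smax *; apply: (row_le_first lT ox0).
  by apply: smax; lia.
have os : row_opt T x s by apply: ox; lia.
have xs1 : enorm (x s.-1) <= enorm (x s) by apply: smax; lia.
have [sT|sT] := eqVneq s T.
  by rewrite sT in os xs1 *; apply: (row_le_last _ os xs1); lia.
apply: row_le_interior os xs1 _; first by lia.
by apply: smax; lia.
Qed.

Lemma delta_ge_third : 3^-1 <= (2 * L - mu) / (2 * L + mu).
Proof. by rewrite ler_pdivlMr; have := mu_gt0; have := muL; lra. Qed.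

Variables (B : nat) (z : nat -> nat -> 'cV[R]_n).
Hypotheses (B_gt0 : (0 < B)%N) (ztr : truncated_solution f B z).

Lemma buffer_row_opt T t : (B <= T)%N -> (T - B < t <= T)%N -> row_opt T (z T) t.
Proof.
move=> BT; apply: argmin_trunc_row_opt; first by rewrite B_gt0.
have [_ zmin zfin] := ztr.
by rewrite [z T (T - B)%N]zfin ?subnK//; exact: zmin.
Qed.

Lemma init_row_opt T t : (T < B)%N -> (t <= maxn T 1)%N ->
  row_opt (maxn T 1) (z T) t.
Proof. by move=> TB; apply: argmin_J_row_opt; have [+ _ _] := ztr; exact. Qed.

Lemma buffer_le T t : (T - B <= t <= maxn T 1)%N -> enorm (z T t) <= frame_bound.
Proof.
elim/ltn_ind: T t => T IH t; have [TB|BT] := ltnP T B.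
  move=> tT; apply: (@frames_le 0 (maxn T 1)); first by lia.
  - by left; split=> //; exact: init_row_opt.
  - by move=> s sT; apply: init_row_opt => //; lia.
  - by lia.
move=> tT; apply: (@frames_le (T - B) T); first by lia.
- right; have [_ _ zfin] := ztr; rewrite zfin ?subnK// /final_frame.
  by rewrite subnK//; apply: IH; lia.
- by move=> s sT; exact: buffer_row_opt.
- by lia.
Qed.

Variable xhat : nat -> nat -> 'cV[R]_n.
Hypothesis xhat_min : forall T, (0 < T)%N -> is_argmin (J f T) (xhat T).

Lemma xhat_le T t : (0 < T)%N -> (t <= T)%N -> enorm (xhat T t) <= frame_bound.
Proof.
move=> T0 tT; apply: (@frames_le 0 T) => //.
- by left; split=> //; apply: argmin_J_row_opt => //; exact: xhat_min.
- by move=> s /andP[_ sT]; apply: argmin_J_row_opt => //; exact: xhat_min.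
Qed.

Lemma xhat_cauchy t N N' : (maxn t 1 <= N <= N')%N ->
  enorm (xhat N t - xhat N' t) <= 3 * frame_bound * 3^-1 ^+ (N - t).
Proof.
move=> tN; have N0 : (0 < N)%N by lia.
pose a s := enorm (xhat N s - xhat N' s).
have aN : a N <= 2 * frame_bound.
  rewrite /a (le_trans (enorm_dist_le _ _))// mulr_natl mulr2n lerD//.
    exact: xhat_le.
  by apply: xhat_le; lia.
have ox s : (s <= N)%N -> row_opt N (xhat N) s.
  by apply: argmin_J_row_opt; exact: xhat_min.
have ox' s : (s <= N)%N -> row_opt N' (xhat N') s.
  by move=> sN; apply: argmin_J_row_opt; [apply: xhat_min|]; lia.
have := @decay0 _ a N N0 (fun s => enorm_ge0 _) _ _ t.
rewrite -/(a t) => /(_ _ _ _)/le_trans; apply.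
- by apply: row_first (ox _ _) (ox' _ _); lia.
- by move=> s sN; apply: row_interior (ox _ _) (ox' _ _); lia.
- by lia.
have r0 : 0 <= 3^-1 ^+ (N - t) :> R by rewrite exprn_ge0// invr_ge0.
by have := ler_wpM2l r0 aN; lra.
Qed.

Lemma final_frame_dist N t : (t + B <= N)%N ->
  enorm (xhat N t - final_frame B z t) <= 10 * frame_bound * 3^-1 ^+ B.
Proof.
have K0 : 0 <= frame_bound.
  apply: le_trans (xhat_le (ltn0Sn 0) (ltn0Sn 0)); exact: enorm_ge0.
move=> tN; have N0 : (0 < N)%N by lia.
have ox s : (s <= N)%N -> row_opt N (xhat N) s.
  by apply: argmin_J_row_opt; exact: xhat_min.
have [_ _ zfin] := ztr.
have aK T s : (T - B <= s <= maxn T 1)%N -> (s <= N)%N ->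
    enorm (xhat N s - z T s) <= 2 * frame_bound.
  move=> sT sN; rewrite (le_trans (enorm_dist_le _ _))// mulr_natl mulr2n lerD//.
    by apply: xhat_le.
  exact: buffer_le.
have r0 k : 0 <= 3^-1 ^+ k :> R by rewrite exprn_ge0// invr_ge0.
suff : enorm (xhat N t - final_frame B z t) <=
    16 / 5 * frame_bound * 3^-1 ^+ B.-1.
  move=> /le_trans; apply; rewrite -{2}(prednK B_gt0) exprSr.
  by have := mulr_ge0 K0 (r0 B.-1); lra.
elim: t tN => [|t IH] tN.
  pose a s := enorm (xhat N s - z B.-1 s); pose T := maxn B.-1 1.
  have oz s : (s <= T)%N -> row_opt T (z B.-1) s.
    by apply: init_row_opt; lia.
  have := @decay0 _ a T _ (fun s => enorm_ge0 _) _ _ 0.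
  rewrite /final_frame add0n subn1 -/(a 0) => /(_ _ _ _ _)/le_trans; apply.
  - by lia.
  - by apply: row_first (ox _ _) (oz _ _); lia.
  - by move=> s sT; apply: row_interior (ox _ _) (oz _ _); lia.
  - by [].
  have aTK : a T <= 2 * frame_bound by apply: aK; lia.
  have rT : 3^-1 ^+ (T - 0) <= 3^-1 ^+ B.-1 :> R.
    by apply: ler_wiXn2l; [rewrite invr_ge0|rewrite invf_le1 ?ler1n|lia].
  have := ler_pM (r0 _) (enorm_ge0 _) rT aTK.
  by have := mulr_ge0 K0 (r0 B.-1); rewrite -/(a T); lra.
pose T := (t + B)%N; pose a s := enorm (xhat N s - z T s).
have at_ : a t = enorm (xhat N t - final_frame B z t) by rewrite /a zfin.
have aS : a t.+1 = enorm (xhat N t.+1 - final_frame B z t.+1).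
  by rewrite /a /final_frame addSn subn1.
have := @decay _ a (a t) t T (enorm_ge0 _) (fun s => enorm_ge0 _) _ _ B.-1 0.
rewrite addn0 aS expr1 => /(_ _ _ _)/le_trans; apply.
- by rewrite lerDl mulr_ge0 ?enorm_ge0.
- move=> s sT; apply: row_interior (ox _ _) (buffer_row_opt _ _); lia.
- by rewrite /T; lia.
have aTK : a T <= 2 * frame_bound by apply: aK; lia.
have := ler_wpM2l (r0 B.-1) aTK.
by have := IH (ltnW tN); rewrite -at_; lra.
Qed.

Lemma lim_final_frame_dist t :
  enorm (lim (xhat T t @[T --> \oo]) - final_frame B z t) <=
    10 * frame_bound * 3^-1 ^+ B.
Proof.
apply: (@enorm_lim_le _ _ (fun N => xhat N t) _ _ (t + B)%N); last first.
  by move=> N; exact: final_frame_dist.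
apply: (@enorm_cauchy_cvg _ _ (fun N => xhat N t) (3 * frame_bound) (maxn t 1)).
move=> N N' tN; rewrite (le_trans (xhat_cauchy tN))// ler_wpM2l//.
  rewrite mulr_ge0//; apply: le_trans (xhat_le (ltn0Sn 0) (ltn0Sn 0)).
  exact: enorm_ge0.
by apply: ler_wiXn2l; [rewrite invr_ge0|rewrite invf_le1 ?ler1n|lia].
Qed.
End Streaming.

Lemma strongly_convexW (R : realType) m (a b : R) (g : 'cV[R]_m -> R) :
  b <= a -> strongly_convex a g -> strongly_convex b g.
Proof.
move=> ba cg p q c c01; apply: le_trans (cg p q c c01) _.
rewrite lerD2l lerN2 ler_wpM2r ?sqr_ge0// ler_wpM2r//; last by lra.
by case/andP: c01 => c0 c1; rewrite mulr_ge0// subr_ge0.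
Qed.

Theorem theorem4 (R : realType) (mu_min L_max M_x : R) :
  exists C_b : R, 0 < C_b /\
  forall (n : nat) (f : nat -> 'cV[R]_(n + n) -> R) (mu L : nat -> R)
    (kappa delta theta : R)
    (xbar : nat -> 'cV[R]_(n + n)) (xhat : nat -> nat -> 'cV[R]_n)
    (B : nat) (zhat : nat -> nat -> 'cV[R]_n),
  (forall t, (1 <= t)%N -> S21 (mu t) (L t) (f t)) ->
  0 < mu_min ->
  (forall t, (1 <= t)%N -> mu_min <= mu t /\ mu t <= L t /\ L t <= L_max) ->
  kappa = (2 * L_max + mu_min) / 2 ->
  delta = (2 * L_max - mu_min) / (2 * L_max + mu_min) ->
  0 < theta -> theta < (1 - delta) / 2 ->
  (forall (t : nat) (x : nat -> 'cV[R]_n),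
      opnorm (offdiag f t x) <= kappa * theta) ->
  (forall t, (1 <= t)%N -> is_argmin (f t) (xbar t)) ->
  (forall t, (1 <= t)%N -> enorm (xbar t) <= M_x) ->
  (forall T, (1 <= T)%N -> is_argmin (J f T) (xhat T)) ->
  (1 <= B)%N ->
  truncated_solution f B zhat ->
  forall t : nat,
    enorm (lim (xhat T t @[T --> \oo]) - final_frame B zhat t) <=
      C_b * ((2 * L_max - mu_min) / (2 * L_max + mu_min)) ^+ B.
Proof.
exists (10 * `|frame_bound mu_min L_max M_x| + 1); split.
  by rewrite ltr_wpDl// mulr_ge0.
move=> n f mu L kappa delta theta xbar xhat B zhat fS mu0 muL -> -> th0 thd off
  xbmin xbM xhmin B1 zt t.
have muLm : mu_min <= L_max.
  by have [h1 [h2 h3]] := muL 1%N isT; exact: le_trans (le_trans h1 h2) h3.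
have D0 : 0 < 2 * L_max + mu_min by lra.
have kth : (2 * L_max + mu_min) / 2 * theta <= mu_min / 2.
  have -> : mu_min / 2 = (2 * L_max + mu_min) / 2 *
      ((1 - (2 * L_max - mu_min) / (2 * L_max + mu_min)) / 2).
    by field; rewrite gt_eqF.
  by rewrite ler_wpM2l ?divr_ge0 ?ltW.
have H := @lim_final_frame_dist R n f mu_min L_max M_x xbar mu0 muLm _ _ _ xbmin xbM
  B zhat B1 zt xhat xhmin t.
apply: le_trans (H _ _ _) _.
- move=> s s0; have [h1 _ _] := fS s s0.
  by apply: strongly_convexW h1; have [] := muL s s0.
- move=> s u u' v v' s0; have [_ h2 _] := fS s s0.
  apply: normr_cross h2 _ => p.
  have := off s.-1 (fun r => if r == s.-1 then usubmx p else dsubmx p).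
  rewrite /offdiag prednK// eqxx gtn_eqF ?prednK// vsubmxK => /le_trans.
  exact.
- move=> s q s0; have [_ [C1 _] h3] := fS s s0.
  rewrite (le_trans (smooth_growth q C1 h3 (xbmin s s0)))// ler_wpM2r ?sqr_ge0//.
  by have [_ []] := muL s s0.
have d3 := delta_ge_third mu0 muLm.
have r0 : 0 <= 3^-1 :> R by rewrite invr_ge0.
apply: (@le_trans _ _ ((10 * `|frame_bound mu_min L_max M_x| + 1) * 3^-1 ^+ B)).
  rewrite ler_wpM2r ?exprn_ge0//.
  by rewrite (le_trans (ler_wpM2l _ (ler_norm _)))// lerDl.
rewrite ler_wpM2l ?addr_ge0 ?mulr_ge0//.
by rewrite lerXn2r// nnegrE (le_trans r0).
Qed.
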